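(* Let $(\epsilon_k)_{k\ge 1}$ be any sequence of positive real numbers converging to zero, and regard each $D_{\epsilon_k}$ as an operator from $L^2(\mathbb{R})$ to $L^2(\mathbb{R})$. Then $$\sum_{k=1}^{\infty}\left\|D_{\epsilon_{k+1}}-D_{\epsilon_k}\right\|_2=\infty,$$ where $\|\cdot\|_2$ denotes the operator norm on $L^2(\mathbb{R})$.
   Context: For $\epsilon>0$ and $f\in L^2(\mathbb{R})$, $D_\epsilon f(x)=(\varphi_\epsilon * f)(x)=\frac{1}{2\epsilon}\int_{-\epsilon}^{\epsilon} f(x-y)\,dy$, where $\varphi_\epsilon=\frac{1}{2\epsilon}1_{[-\epsilon,\epsilon]}$. *)

(* Defs.v *)
From HB Require Import structures.
From mathcomp Require Import all_boot all_order all_algebra.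
From mathcomp Require Import all_classical all_reals all_analysis.
From mathcomp Require Import measurable_realfun lra.
Import Order.TTheory GRing.Theory Num.Theory.
Import numFieldNormedType.Exports.

Set Implicit Arguments.
Unset Strict Implicit.
Unset Printing Implicit Defensive.

Local Open Scope classical_set_scope.
Local Open Scope ring_scope.

(* Real-valued functions, not quotiented by a.e. equality: L2norm is a seminorm
   that does not distinguish a.e. equal functions, nor does avg below. *)
Notation L2 R := (LfunType (@lebesgue_measure R) (lee1n 2)).

Definition L2norm (R : realType) (f : L2 R) : \bar R :=
  'N[@lebesgue_measure R]_(2%:E)[EFin \o f]%E.

Definition opnorm (R : realType) (T : {linear L2 R -> L2 R}) : \bar R :=
  ereal_sup [set L2norm (T f) | f in [set f : L2 R | (L2norm f <= 1)%E]].

Definition avg (R : realType) (eps : R) (f : R -> R) (x : R) : R :=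
  (2 * eps)^-1 * \int[@lebesgue_measure R]_(y in `[- eps, eps]) f (x - y).

Section avg_L2.
Variable R : realType.
Notation mu := (@lebesgue_measure R).
Notation X := (measurableTypeR R).
Implicit Types (eps x y : R).

Lemma measurable_reflect (x : R) : measurable_fun [set: X] (fun y : X => x - y : X).
Proof. exact: measurable_funB. Qed.

Lemma measurable_subr2 : measurable_fun [set: X * X] (fun z : X * X => z.1 - z.2 : X).
Proof. exact: measurable_funB. Qed.

Let reflected x : {measure set X -> \bar R} :=
  measure_function_pushforward__canonical__measure_function_Measure
    mu (measurable_reflect x).

Lemma lebesgue_reflect (x : R) (A : set X) : measurable A ->
  mu A = pushforward mu (fun y : X => x - y : X) A.
Proof.
move=> mA.
apply: (@lebesgue_measure_unique R (reflected x)) => // _ [[a b] _ <-] /=.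
rewrite /pushforward /=.
have -> : (fun y => x - y) @^-1` `]a, b]%classic = `[x - b, x - a[%classic.
  by apply/seteqP; split => y /=; rewrite !in_itv /= => /andP[? ?]; lra.
rewrite !lebesgue_measure_itv /= !lte_fin ltrD2l ltrN2.
by case: ifP => // _; rewrite -!EFinB; congr EFin; lra.
Qed.

Lemma ge0_integral_reflect (x : R) (g : X -> \bar R) :
  measurable_fun setT g -> (forall t, (0 <= g t)%E) ->
  (\int[mu]_y g ((x - y)%R : R) = \int[mu]_y g y)%E.
Proof.
move=> mg g0.
have := @ge0_integral_pushforward _ _ X X R _ (measurable_reflect x) mu setT g
   measurableT mg (fun y _ => g0 y).
rewrite preimage_setT => <-.
apply: (@eq_measure_integral _ _ _ _ mu (reflected x)) => A mA _.
exact/esym/lebesgue_reflect.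
Qed.

Lemma ge0_integral_translate (y : R) (g : X -> \bar R) :
  measurable_fun setT g -> (forall t, (0 <= g t)%E) ->
  (\int[mu]_x g ((x - y)%R : R) = \int[mu]_x g x)%E.
Proof.
move=> mg g0.
rewrite -(ge0_integral_reflect 0 mg g0).
rewrite -(@ge0_integral_reflect y (fun t => g ((0 - t)%R : R)))//.
  by apply: eq_integral => x _; congr g; rewrite sub0r opprB.
exact: measurableT_comp mg (measurable_reflect 0).
Qed.

Lemma avg_le0 eps (f : R -> R) : eps <= 0 -> avg eps f = cst 0.
Proof.
rewrite le_eqVlt => /orP[/eqP ->|e0]; apply/funext => x; rewrite /avg.
  by rewrite mulr0 invr0 mul0r.
rewrite set_itv_ge ?Rintegral_set0 ?mulr0//.
by rewrite bnd_simp -ltNge; lra.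
Qed.

Section fix_f.
Variable f : L2 R.

Lemma L2_measurable : measurable_fun [set: X] (f : X -> R).
Proof. by []. Qed.

Lemma L2_sqr_lty : (\int[mu]_x ((f x) ^+ 2)%:E < +oo)%E.
Proof.
have := @Lfun2_integrable_sqr _ _ _ mu f (LfunP f).
move=> /integrableP[_]; apply: le_lt_trans.
apply: ge0_le_integral => //=.
- by move=> x _; rewrite lee_fin sqr_ge0.
- exact/measurable_EFinP/measurable_funX.
- apply/measurable_EFinP; apply: measurableT_comp => //.
  exact: measurable_funX.
- by move=> x _; rewrite lee_fin ler_norm.
Qed.

Lemma integrable_reflect_sqr (x : R) (D : set X) : measurable D ->
  mu.-integrable D (fun y => ((f (x - y)) ^+ 2)%:E).
Proof.
move=> mD; apply: (@integrableS _ _ _ mu setT) => //.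
apply/integrableP; split.
  apply/measurable_EFinP/measurable_funX.
  exact: measurableT_comp L2_measurable (measurable_reflect x).
under eq_integral do rewrite gee0_abs ?lee_fin ?sqr_ge0//.
rewrite (@ge0_integral_reflect x (fun t => (f t ^+ 2)%:E)) ?L2_sqr_lty//.
  by apply/measurable_EFinP/measurable_funX.
by move=> t; rewrite lee_fin sqr_ge0.
Qed.

Lemma integrable_cst_itv (a b c : R) :
  mu.-integrable `[a, b] (fun=> c%:E).
Proof.
apply/integrableP; split; first exact: measurable_cst.
rewrite integral_cst//=.
rewrite lte_mul_pinfty ?lee_fin// lebesgue_measure_itv.
by case: ifP; rewrite ?ltry// => _; rewrite -EFinB ltry.
Qed.

Lemma integrable_reflect (x a b : R) :
  mu.-integrable `[a, b] (fun y => (f (x - y))%:E).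
Proof.
have mI : measurable (`[a, b] : set X) by exact: measurable_itv.
apply: (@le_integrable _ _ _ mu _ mI _ (fun y => (1 + (f (x - y)) ^+ 2)%:E)).
- apply/measurable_EFinP; apply: measurable_funTS.
  exact: measurableT_comp L2_measurable (measurable_reflect x).
- move=> y _; rewrite lee_fin [leRHS]ger0_norm ?addr_ge0 ?sqr_ge0//.
  rewrite -[f _ ^+ 2]real_normK ?num_real//.
  have := sqr_ge0 (`|f (x - y)| - 1).
  have := normr_ge0 (f (x - y)); nra.
- apply: (@integrableD _ _ _ mu _ mI (fun=> 1%:E)
    (fun y => (f (x - y) ^+ 2)%:E)); last exact: integrable_reflect_sqr.
  exact: integrable_cst_itv.
Qed.

Let I eps : set X := `[- eps, eps].

Let mI eps : measurable (I eps). Proof. exact: measurable_itv. Qed.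

Let mkernel eps (h : X -> R) : measurable_fun setT h ->
  measurable_fun [set: X * X]
    (fun z : X * X => (h (z.1 - z.2) * \1_(I eps) z.2)%:E).
Proof.
move=> mh; apply/measurable_EFinP; apply: measurable_funM.
  exact: measurableT_comp mh measurable_subr2.
have mind : measurable_fun setT (\1_(I eps) : X -> R) by exact: measurable_indic.
exact: measurableT_comp mind measurable_snd.
Qed.

Let integral_indicM eps (h : X -> R) :
  (\int[mu]_(y in I eps) (h y)%:E = \int[mu]_y (h y * \1_(I eps) y)%:E)%E.
Proof.
rewrite integral_mkcond; apply: eq_integral => y _.
by rewrite patchE indicE; case: (y \in I eps); rewrite ?mulr1 ?mulr0.
Qed.

Lemma measurable_avg eps : measurable_fun [set: X] (avg eps f : X -> R).
Proof.
apply: measurable_funM => //.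
rewrite /Rintegral; apply: measurableT_comp => //.
have mpos (h : X -> R) : measurable_fun setT h -> (forall t, 0 <= h t) ->
    measurable_fun setT (fun x : X => \int[mu]_(y in I eps) (h (x - y))%:E)%E.
  move=> mh h0.
  have := @measurable_fun_fubini_tonelli_F _ _ _ _ _ mu _ (mkernel eps mh).
  rewrite (_ : fubini_F _ _ =
      fun x : X => (\int[mu]_(y in I eps) (h (x - y))%:E)%E); last first.
    by apply/funext => x; rewrite integral_indicM.
  by apply=> z; rewrite lee_fin mulr_ge0 ?indicE.
have mfp : measurable_fun setT (f^\+%R : X -> R) by exact: measurable_funrpos.
have mfn : measurable_fun setT (f^\-%R : X -> R) by exact: measurable_funrneg.
rewrite (_ : (fun x => _) = (fun x : X =>
   (\int[mu]_(y in I eps) (f^\+%R (x - y))%:E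
    - \int[mu]_(y in I eps) (f^\-%R (x - y))%:E)%E)); last first.
  apply/funext => x; rewrite integralE; congr (_ - _)%E;
    by apply: eq_integral => y _; rewrite ?funeposE ?funenegE/= ?EFin_max.
apply: emeasurable_funB; apply: mpos => // t.
Qed.

Lemma avg_sqr_le eps x : 0 < eps ->
  (((avg eps f x) ^+ 2)%:E <=
   (2 * eps)^-1%:E * \int[mu]_y ((f (x - y)) ^+ 2 * \1_(I eps) y)%:E)%E.
Proof.
move=> e0; set m := avg eps f x.
have e20 : 0 < 2 * eps by rewrite mulr_gt0.
have muI : mu (I eps) = (2 * eps)%:E.
  rewrite /I lebesgue_measure_itv/= lte_fin ifT; last by lra.
  by rewrite -EFinB; congr EFin; lra.
have if1 : mu.-integrable (I eps) (fun y => (f (x - y))%:E).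
  exact: integrable_reflect.
have if2 : mu.-integrable (I eps) (fun y => ((f (x - y)) ^+ 2)%:E).
  exact: integrable_reflect_sqr.
have ic (c : R) : mu.-integrable (I eps) (fun y => c%:E).
  exact: integrable_cst_itv.
have ifm : mu.-integrable (I eps) (fun y => (2 * m * f (x - y) )%:E).
  exact: (@integrableZl _ _ _ mu _ (mI eps) (2 * m) (fun y => (f (x - y))%:E)).
have le2 : \int[mu]_(y in I eps) (2 * m * f (x - y) - m ^+ 2)
        <= \int[mu]_(y in I eps) (f (x - y) ^+ 2).
  apply: le_Rintegral => //.
    exact: (@integrableB _ _ _ mu _ (mI eps) (fun y => (2 * m * f (x - y))%:E) (fun=> (m ^+ 2)%:E)).
  by move=> y _; have := sqr_ge0 (f (x - y) - m); nra.
have mE : \int[mu]_(y in I eps) f (x - y) = 2 * eps * m.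
  by rewrite /m /avg mulrA mulfV ?mul1r// gt_eqF.
have mE2 : \int[mu]_(y in I eps) (2 * m * f (x - y) - m ^+ 2)
    = 2 * m * (2 * eps * m) - m ^+ 2 * (2 * eps).
  rewrite (@RintegralB _ _ _ mu _ (fun y => 2 * m * f (x - y)) (fun=> m ^+ 2))//; last exact: ic.
  rewrite (@RintegralZl _ _ _ mu _ (fun y => f (x - y)))// mE.
  rewrite Rintegral_cst//.
  by congr (_ - _ * _); rewrite -[RHS]/(fine (2 * eps)%:E) -muI.
rewrite {}mE2 in le2.
rewrite -integral_indicM.
have /fineK <- := integrable_fin_num (mI eps) if2.
rewrite -EFinM lee_fin -ler_pdivrMl ?invr_gt0// invrK.
by apply: le_trans le2; lra.
Qed.

Lemma avg_Lfun eps : avg eps f \in Lfun mu 2%:E.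
Proof.
have [e0|e0] := leP eps 0.
  rewrite avg_le0//; exact: (LfunP (0 : L2 R)).
rewrite inE; apply/andP; split; rewrite inE/=; first exact: measurable_avg.
rewrite /finite_norm unlock poweR_lty//.
pose c := (2 * eps)^-1.
have c0 : 0 <= c by rewrite invr_ge0 mulr_ge0// ltW.
pose k (z : X * X) := (f (z.1 - z.2) ^+ 2 * \1_(I eps) z.2)%:E.
have msq : measurable_fun setT (fun t : X => f t ^+ 2) by exact: measurable_funX.
have mk : measurable_fun setT k by exact: mkernel msq.
have k0 z : (0 <= k z)%E by rewrite lee_fin mulr_ge0 ?sqr_ge0.
have mF := @measurable_fun_fubini_tonelli_F _ _ _ _ _ mu _ mk k0.
apply: (@le_lt_trans _ _ (\int[mu]_x (c%:E * fubini_F mu k x))%E).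
  apply: ge0_le_integral => //.
  - by move=> x _; exact: poweR_ge0.
  - apply: (@measurableT_comp _ _ _ _ _ _ (fun x : \bar R => x `^ 2)%E) => //.
      exact: measurable_poweR.
    do 2 apply: measurableT_comp => //.
    exact: measurable_avg.
  - exact: measurable_funeM.
  - move=> x _; rewrite [(_ `^ 2)%E]poweR_EFin powR_mulrn// real_normK ?num_real//.
    exact: avg_sqr_le.
rewrite ge0_integralZl//; last first.
  by move=> x _; apply: integral_ge0.
rewrite lte_mul_pinfty//.
rewrite fubini_tonelli//.
have -> : (\int[mu]_y \int[mu]_x k (x, y))%E =
    (\int[mu]_y ((\int[mu]_x (f x ^+ 2)%:E) * (\1_(I eps) y)%:E))%E.
  apply: eq_integral => y _.
  under eq_integral do rewrite /k/= EFinM.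
  rewrite ge0_integralZr//.
  - congr (_ * _)%E.
    rewrite (@ge0_integral_translate y (fun t => (f t ^+ 2)%:E))//.
      exact/measurable_EFinP.
    by move=> t; rewrite lee_fin sqr_ge0.
  - apply/measurable_EFinP/measurable_funX.
    exact: measurableT_comp L2_measurable (measurable_funB _ _).
  - by move=> x _; rewrite lee_fin sqr_ge0.
rewrite ge0_integralZl//.
- rewrite integral_indic// setIT lte_mul_pinfty//.
  + by apply: integral_ge0 => x _; rewrite lee_fin sqr_ge0.
  + rewrite ge0_fin_numE ?L2_sqr_lty//.
    by apply: integral_ge0 => x _; rewrite lee_fin sqr_ge0.
  + rewrite [X in (X < _)%E]lebesgue_measure_itv.
    by case: ifP; rewrite ?ltry// => _; rewrite -EFinB ltry.
- exact/measurable_EFinP/measurable_indic.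
- by apply: integral_ge0 => x _; rewrite lee_fin sqr_ge0.
Qed.

End fix_f.
End avg_L2.

Definition D (R : realType) (eps : R) (f : L2 R) : L2 R :=
  Lfun_Sub (lee1n 2) (avg_Lfun f eps).

Lemma D_linear (R : realType) (eps : R) : linear (@D R eps).
Proof.
move=> a f g; apply/LfuneqP => x.
transitivity (avg eps (fun t => a * f t + g t) x); first by [].
transitivity (a * avg eps f x + avg eps g x); last by [].
have mI : measurable (`[- eps, eps] : set (measurableTypeR R)).
  exact: measurable_itv.
have intf := integrable_reflect f x (- eps) eps.
have intg := integrable_reflect g x (- eps) eps.
rewrite /avg (@RintegralD _ _ _ lebesgue_measure _
  (fun y => a * f (x - y)) (fun y => g (x - y)))//; last first.
  exact: (@integrableZl _ _ _ _ _ mI a (fun y => (f (x - y))%:E)).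
rewrite (@RintegralZl _ _ _ lebesgue_measure _ (fun y => f (x - y)))//.
by rewrite mulrDr mulrCA.
Qed.

HB.instance Definition _ (R : realType) (eps : R) :=
  GRing.isLinear.Build R (L2 R) (L2 R) _ (@D R eps) (@D_linear R eps).

(* Main.v *)
Require Import Defs.
From mathcomp Require Import all_boot all_order all_algebra.
From mathcomp Require Import all_classical all_reals all_analysis.
From mathcomp Require Import measurable_realfun ring lra.
Import Order.TTheory GRing.Theory Num.Theory.
Import numFieldNormedType.Exports.
Local Open Scope classical_set_scope.
Local Open Scope ring_scope.

(** A lower bound on each norm by the relative decrease of the radius forces
divergence, because the product of the ratios of successive radii is zero.

For 0 < a < b the bound is || D_a - D_b || >= (1 - a/b) / 16
([opnorm_D_sub_ge]). The multiplier sin(t xi)/(t xi) of D_t suggests such a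
bound by scaling, but no Fourier transform is used: a step function already
sees the difference. Let f be a multiple of the indicator of [0, 2b], of norm 1.
In units of the height of f, the average D_t f near the jump at 0 is a ramp of
slope 1/(2t), which reaches its plateau at x = t. On the middle half of [0, b]
the averages for t = a and t = b therefore differ by at least (1 - a/b)/8 times
the height, and that interval is a fixed fraction of the support of f.

For the sequence, write s_k = || D_{eps_(k+1)} - D_{eps_k} ||. The bound gives
eps_(k+1) >= eps_k (1 - 16 s_k), trivially so when the radius does not decrease.
If the s_k were summable, some tail of 16 s_k would have sum below 1/2, and the
inequality prod (1 - t_k) >= 1 - sum t_k would keep eps_n above half of a fixed
positive eps_N, against eps_n --> 0 ([nneseries_relative_decrease_pinfty]). *)

(** The infinite product of the ratios u_(k+1)/u_k vanishes, so the relative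
decreases 1 - u_(k+1)/u_k cannot be summable. The sequence u may oscillate: the
bound on s is asked for only at the steps where u decreases, since the other
steps help. *)
Lemma nneseries_relative_decrease_pinfty (R : realType) (c : R) (u : nat -> R)
    (s : nat -> \bar R) :
  0 < c -> (forall k, 0 < u k) -> u @ \oo --> (0 : R) ->
  (forall k, (0 <= s k)%E) ->
  (forall k, u k.+1 < u k -> ((c * (1 - u k.+1 / u k))%:E <= s k)%E) ->
  (\sum_(0 <= k <oo) s k = +oo)%E.
Proof.
move=> c0 u0 ucvg s0 su.
apply/eqP; rewrite eq_le leey /= leNgt; apply/negP => sfin.
have tail := @nneseries_tail_cvg _ _ xpredT sfin (fun k _ => s0 k).
have [N _ /(_ N (leqnn N)) sN] :
    \forall N \near \oo, (\sum_(N <= k <oo) s k < (c / 2)%:E)%E.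
  apply: (tail [set x | (x < (c / 2)%:E)%E]).
  by apply: open_nbhs_nbhs; split; [exact: open_ereal_lt_ereal|rewrite /= lte_fin divr_gt0].
have psum n : (\sum_(N <= k < n) s k < (c / 2)%:E)%E.
  by apply: le_lt_trans sN; exact: nneseries_lim_ge.
have sfine k : (N <= k)%N -> s k = (fine (s k))%:E.
  move=> Nk; rewrite fineK// ge0_fin_numE//.
  apply: (@le_lt_trans _ _ (\sum_(N <= i < k.+1) s i)%E).
    by rewrite big_nat_recr//= leeDr// sume_ge0.
  exact: lt_trans (psum _) (ltry _).
(* From N on all terms are finite, and t k bounds the relative decrease of u. *)
pose t k := fine (s k) / c.
have t0 k : 0 <= t k by rewrite divr_ge0 ?fine_ge0 // ltW.
have sumt n : \sum_(N <= k < n) t k < 2^-1.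
  rewrite -mulr_suml ltr_pdivrMr// -lte_fin mulrC -[X in (_ < X)%E]/(c / 2)%:E.
  rewrite -sumEFin; apply: le_lt_trans (psum n).
  rewrite big_nat_cond [leRHS]big_nat_cond; apply: lee_sum => k /andP[/andP[Nk _] _].
  by rewrite -sfine.
have tu k : (N <= k)%N -> u k * (1 - t k) <= u k.+1.
  move=> Nk; have uk := u0 k.
  have [uu|uu] := leP (u k) (u k.+1).
    apply: le_trans uu; rewrite ler_piMr// ?gerBl//; exact: ltW.
  have := su _ uu; rewrite sfine// lee_fin mulrC -ler_pdivlMr// -/(t k) => h.
  rewrite mulrC -ler_pdivlMr//; lra.
(* The product of the 1 - t k is at least 1 minus the sum of the t k. *)
have low n : u N * (1 - \sum_(N <= k < N + n) t k) <= u (N + n)%N.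
  elim: n => [|n IH]; first by rewrite addn0 big_geq// subr0 mulr1.
  rewrite addnS big_nat_recr/= ?leq_addr//.
  have tn := tu _ (leq_addr n N).
  have S1 := sumt (N + n).+1; rewrite big_nat_recr/= ?leq_addr// in S1.
  have S0 : 0 <= \sum_(N <= k < N + n) t k by rewrite sumr_ge0.
  have tn0 := t0 (N + n)%N.
  apply: le_trans tn.
  set S := \sum_(_ <= _ < _) _ in IH S0 S1 *; set x := t _ in tn0 S1 *.
  apply: (@le_trans _ _ (u N * (1 - S) * (1 - x))).
    by rewrite -mulrA ler_pM2l//; nra.
  by rewrite ler_wpM2r//; lra.
have [M _ uM] : \forall n \near \oo, u n < u N / 2.
  by apply: cvgr_lt ucvg _ _; rewrite divr_gt0.
have := uM (N + M)%N (leq_addl _ _); have := low M; have := sumt (N + M)%N.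
have := u0 N; nra.
Qed.

Lemma L2normE (R : realType) (f : L2 R) :
  L2norm f = ((\int[@lebesgue_measure R]_x (f x ^+ 2)%:E) `^ 2^-1)%E.
Proof.
rewrite /L2norm unlock; congr (_ `^ _)%E; apply: eq_integral => x _ /=.
by rewrite powR_mulrn// real_normK ?num_real.
Qed.

Lemma L2norm_ge0 (R : realType) (f : L2 R) : (0 <= L2norm f)%E.
Proof. exact: Lnorm_ge0. Qed.

(** Chebyshev's inequality: |f| >= c on a set of measure m gives
||f|| >= c sqrt(m), written here without the square root. *)
Lemma L2norm_ge (R : realType) (f : L2 R) (c d m : R) (A : set (measurableTypeR R)) :
  measurable A -> lebesgue_measure A = m%:E -> 0 <= c -> 0 <= d ->
  (forall x, A x -> c <= `|f x|) -> d ^+ 2 <= c ^+ 2 * m ->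
  (d%:E <= L2norm f)%E.
Proof.
move=> mA muA c0 d0 cf dm.
have -> : d%:E = ((d ^+ 2)%:E `^ 2^-1)%E.
  by rewrite poweR_EFin -powR_mulrn// -powRrM mulfV// powRr1.
rewrite L2normE; apply: gt0_ler_poweR; rewrite ?invr_ge0 ?in_itv /= ?leey ?andbT //.
- by rewrite lee_fin sqr_ge0.
- by apply: integral_ge0 => x _; rewrite lee_fin sqr_ge0.
- apply: (@le_trans _ _ (\int[lebesgue_measure]_(x in A) (c ^+ 2)%:E)%E).
    by rewrite integral_cst//= [X in (_ * X)%E]muA -EFinM lee_fin.
  have mf2 : measurable_fun [set: measurableTypeR R] (fun x => (f x ^+ 2)%:E).
    exact/measurable_EFinP/measurable_funX.
  apply: (@le_trans _ _ (\int[lebesgue_measure]_(x in A) (f x ^+ 2)%:E)%E).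
    apply: ge0_le_integral => //.
    - by move=> x _; rewrite lee_fin sqr_ge0.
    - exact: measurable_funTS.
    - move=> x Ax; rewrite lee_fin -[leRHS]real_normK ?num_real//.
      by rewrite lerXn2r ?nnegrE// cf.
  apply: ge0_subset_integral => //.
  by move=> x _; rewrite lee_fin sqr_ge0.
Qed.

Lemma opnorm_ge (R : realType) (T : {linear L2 R -> L2 R}) (f : L2 R) :
  (L2norm f <= 1)%E -> (L2norm (T f) <= opnorm T)%E.
Proof. by move=> f1; apply: ereal_sup_ubound; exists f. Qed.

Lemma opnorm_ge0 (R : realType) (T : {linear L2 R -> L2 R}) : (0 <= opnorm T)%E.
Proof.
apply: (le_trans (L2norm_ge0 _ (T 0))); apply: opnorm_ge.
rewrite L2normE; under eq_integral do rewrite expr0n/=.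
by rewrite integral0 poweR0r ?invr_eq0 ?pnatr_eq0.
Qed.

(** The test functions. The averages are compared near the jump at 0 only; the
cut at w makes the function square integrable. *)
Definition box {R : realType} (c w : R) : R -> R :=
  fun x => c * \1_(`[0, w] : set R) x.

Lemma integral_box_sqr (R : realType) (c w : R) : 0 < w ->
  (\int[@lebesgue_measure R]_x (box c w x ^+ 2)%:E = (c ^+ 2 * w)%:E)%E.
Proof.
move=> w0; rewrite /box.
have mI : measurable (`[0, w] : set (measurableTypeR R)) by exact: measurable_itv.
have -> : (fun x => ((c * \1_(`[0, w] : set R) x) ^+ 2)%:E) =
    (fun x => (c ^+ 2)%:E * (\1_(`[0, w] : set R) x)%:E)%E.
  apply/funext => x; rewrite -EFinM exprMn indicE.
  by case: (_ \in _); rewrite ?expr1n ?expr0n.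
rewrite ge0_integralZl ?lee_fin ?sqr_ge0//.
- rewrite integral_indic// setIT [X in (_ * X)%E]lebesgue_measure_itv/= lte_fin w0.
  by rewrite -EFinB subr0 -EFinM.
- exact/measurable_EFinP/measurable_indic.
Qed.

Lemma box_Lfun (R : realType) (c w : R) : 0 < w ->
  box c w \in Lfun (@lebesgue_measure R) 2%:E.
Proof.
move=> w0; rewrite inE; apply/andP; split; rewrite inE /=.
  by apply: measurable_funM => //; exact: measurable_indic.
rewrite /finite_norm unlock poweR_lty//.
under eq_integral do rewrite /= powR_mulrn// real_normK ?num_real//.
by rewrite integral_box_sqr// ltry.
Qed.

(** Under these conditions the window [x - e, x + e] does not reach past the
right end of the step, so only the jump at 0 matters: the average is a ramp of
slope c/(2e) up to x = e, and then equals the height c. *)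
Lemma avg_box (R : realType) (c w e x : R) :
  0 <= c -> 0 < e -> 0 <= x -> x + e <= w ->
  avg e (box c w) x = c * ((Num.min x e + e) / (2 * e)).
Proof.
move=> c0 e0 x0 xew; rewrite /avg /Rintegral /box.
have mI (a b : R) : measurable (`[a, b] : set (measurableTypeR R)).
  exact: measurable_itv.
have -> : (fun y : R => (c * \1_(`[0, w] : set R) (x - y))%:E) =
    (fun y => c%:E * (\1_(`[x - w, x] : set R) y)%:E)%E.
  apply/funext => y; rewrite -EFinM !indicE; congr (c * _%:R)%:E.
  by congr nat_of_bool; apply/idP/idP; rewrite !inE/= !in_itv/= => /andP[? ?]; lra.
rewrite ge0_integralZl//; last exact/measurable_EFinP/measurable_indic.
rewrite integral_indic//.
have -> : `[x - w, x] `&` `[- e, e] = `[- e, Num.min x e]%classic.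
  apply/seteqP; split => y /=; rewrite !in_itv/= le_min.
    by move=> [/andP[? ?] /andP[? ?]]; lra.
  by move=> /andP[? /andP[? ?]]; split; lra.
rewrite [X in (_ * X)%E]lebesgue_measure_itv/= lte_fin ifT; last first.
  by rewrite lt_min; lra.
by rewrite -EFinB -EFinM/= opprK mulrC mulrA.
Qed.

(** The width 2b keeps the window [x - b, x + b] clear of the right end of the
step for all x in [0, b]. The quarters of [0, b] next to its ends are discarded
because both averages are c/2 at 0 and c at b, so that their difference vanishes
there. *)
Lemma opnorm_D_sub_ge (R : realType) (a b : R) : 0 < a -> a < b ->
  ((16^-1 * (1 - a / b))%:E <= opnorm (D a \- D b)%R)%E.
Proof.
move=> a0 ab; have b0 : 0 < b by exact: lt_trans ab.
have w0 : 0 < 2 * b by rewrite mulr_gt0.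
(* The height that gives the step norm 1. *)
pose c := (Num.sqrt (2 * b))^-1.
have c0 : 0 <= c by rewrite invr_ge0 sqrtr_ge0.
have c2 : c ^+ 2 = (2 * b)^-1 by rewrite exprVn sqr_sqrtr// ltW.
pose f : L2 R := Lfun_Sub (lee1n 2) (box_Lfun _ c _ w0).
have f1 : (L2norm f <= 1)%E.
  rewrite L2normE integral_box_sqr// c2 mulVf ?gt_eqF//.
  by rewrite poweR_EFin powR1.
have r1 : a / b < 1 by rewrite ltr_pdivrMr// mul1r.
apply: le_trans (@opnorm_ge R (D a \- D b) f f1).
apply: (@L2norm_ge _ _ (c * (8^-1 * (1 - a / b))) _ (b / 2)
  `[b / 4, 3 / 4 * b]%classic).
- exact: measurable_itv.
- rewrite lebesgue_measure_itv/= lte_fin ifT; last by lra.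
  by rewrite -EFinB; congr EFin; lra.
- by rewrite !mulr_ge0//; lra.
- by rewrite mulr_ge0//; lra.
- move=> x /=; rewrite in_itv/= => /andP[x1 x2].
  rewrite -[X in `|X|]/(avg a (box c (2 * b)) x - avg b (box c (2 * b)) x).
  have xb : x <= b by lra.
  rewrite !avg_box//; [|lra..]; rewrite (min_l xb) -mulrBr.
  apply: le_trans (ler_norm _); rewrite ler_wpM2l//.
  (* Before a both averages are on their ramps, whose slopes differ by a factor
     b/a; after a the first one has reached its plateau. *)
  have [xa|ax] := leP x a.
    have -> : (x + a) / (2 * a) - (x + b) / (2 * b) = x / a * (2^-1 * (1 - a / b)).
      by field; rewrite ?gt_eqF.
    have : 4^-1 <= x / a by rewrite ler_pdivlMr//; lra.
    nra.
  have -> : (a + a) / (2 * a) - (x + b) / (2 * b) = 2^-1 * (1 - x / b).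
    by field; rewrite ?gt_eqF.
  have : x / b <= 3 / 4 by rewrite ler_pdivrMr.
  have : 0 < a / b by rewrite divr_gt0.
  lra.
- rewrite [(c * _) ^+ 2]exprMn c2 le_eqVlt; apply/orP; left; apply/eqP.
  by field; rewrite ?gt_eqF.
Qed.

Theorem theorem2p5 (R : realType) (eps : nat -> R)
    (eps_gt0 : forall k, (1 <= k)%N -> 0 < eps k)
    (eps_cvg0 : eps @ \oo --> (0 : R)) :
  (\sum_(1 <= k <oo) opnorm (D (eps k.+1) \- D (eps k))%R = +oo)%E.
Proof.
rewrite -nneseries_addn; last by move=> k; exact: opnorm_ge0.
apply: (@nneseries_relative_decrease_pinfty _ (16^-1) (fun k => eps (k + 1)%N)).
- by rewrite invr_gt0.
- by move=> k; apply: eps_gt0; rewrite addn1.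
- by rewrite cvg_shiftn.
- by move=> k; exact: opnorm_ge0.
- by move=> k; apply: opnorm_D_sub_ge; apply: eps_gt0.
Qed.
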